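(* Let $p\in(2,3)$ and suppose that $S\in D([0,T];\mathbb{R}^d)$ satisfies Property (RIE) with respect to $p$ and a sequence of partitions $(\mathcal{P}^n)_{n\in\mathbb{N}}$ of $[0,T]$. With the notation $\int_s^tS_u\otimes\mathrm{d}S_u:=\int_0^tS_u\otimes\mathrm{d}S_u-\int_0^sS_u\otimes\mathrm{d}S_u$ (where $\int_0^\cdot S_u\otimes\mathrm{d}S_u$ is the limit given by Property (RIE)), define $A:\Delta_{[0,T]}\to\mathbb{R}^{d\times d}$ by $$A_{s,t}=\int_s^tS_u\otimes\mathrm{d}S_u-S_s\otimes S_{s,t},\qquad(s,t)\in\Delta_{[0,T]}.$$ Then the triplet $\mathbf{S}=(S,S,A)$ is a càdlàg $p$-rough path.
   Context: Fix $T>0$ and $d\in\mathbb{N}$. $D([0,T];E)$ is the space of càdlàg functions $[0,T]\to E$, and $\Delta_{[0,T]}:=\{(s,t)\in[0,T]^2:s\le t\}$. For a path $A$ write $A_{s,t}:=A_t-A_s$; for a two-parameter function $A$ on $\Delta_{[0,T]}$, $A_{s,t}$ is its value at $(s,t)$. A partition of $[s,t]$ is a finite set $\{s=t_0<\dots<t_N=t\}$, $[u,v]\in\mathcal{P}$ means that $u<v$ are consecutive points of $\mathcal{P}$, and $|\mathcal{P}|$ is the mesh size. $(a\otimes b)^{ij}=a^ib^j$. $p$-variation ($p\ge1$): $\|A\|_{p,[s,t]}:=\big(\sup_{\mathcal{P}}\sum_{[u,v]\in\mathcal{P}}|A_{u,v}|^p\big)^{1/p}$, the supremum being over partitions of $[s,t]$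 (for paths or two-parameter functions). $D^p$ is the space of càdlàg paths on $[0,T]$ of finite $p$-variation. $D^p_2$ is the space of functions on $\Delta_{[0,T]}$ of finite $p$-variation such that $s\mapsto A_{s,t}$ (for fixed $t$) and $t\mapsto A_{s,t}$ (for fixed $s$) are càdlàg. A control function is a map $w:\Delta_{[0,T]}\to[0,\infty)$ with $w(s,u)+w(u,t)\le w(s,t)$ for $s\le u\le t$. Càdlàg $p$-rough path: a triplet $(X,Z,\mathbb{X})$ with $X,Z\in D^p([0,T];\mathbb{R}^d)$, $\mathbb{X}\in D^{p/2}_2(\Delta_{[0,T]};\mathbb{R}^{d\times d})$ and $\mathbb{X}_{s,t}=\mathbb{X}_{s,u}+\mathbb{X}_{u,t}+Z_{s,u}\otimes X_{u,t}$ for all $0\le s\le u\le t\le T$. Property (RIE): Let $p\in(2,3)$ and let $\mathcal{P}^n=\{0=t^n_0<\cdots<t^n_{N_n}=T\}$, $n\in\mathbb{N}$, be nested partitions ($\mathcal{P}^n\subset\mathcal{P}^{n+1}$) of $[0,T]$ with $|\mathcal{P}^n|\to0$. For $S\in D([0,T];\mathbb{R}^d)$ set $S^n_t=S_T\mathbf{1}_{\{T\}}(t)+\sum_{k=0}^{N_n-1}S_{t^n_k}\mathbf{1}_{[t^n_k,t^n_{k+1})}(t)$ and $\int_0^tS^n_u\otimes\mathrm{d}S_u:=\sum_{k=0}^{N_n-1}S_{t^n_k}\otimes S_{t^n_k\wedge t,t^n_{k+1}\wedge t}$, with $\int_s^t:=\int_0^t-\int_0^s$. $S$ satisfies (RIE)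 with respect to $p$ and $(\mathcal{P}^n)$ if: (a) $S^n\to S$ uniformly; (b) $\int_0^\cdot S^n_u\otimes\mathrm{d}S_u$ converges uniformly on $[0,T]$ to a limit, denoted $\int_0^\cdot S_u\otimes\mathrm{d}S_u$; (c) there is a control function $w$ such that (with $\frac00:=0$) $$\sup_{(s,t)\in\Delta_{[0,T]}}\frac{|S_{s,t}|^p}{w(s,t)}+\sup_{n}\sup_{0\le k<\ell\le N_n}\frac{\big|\int_{t^n_k}^{t^n_\ell}S^n_u\otimes\mathrm{d}S_u-S_{t^n_k}\otimes S_{t^n_k,t^n_\ell}\big|^{p/2}}{w(t^n_k,t^n_\ell)}\le1.$$ *)

(* Defs.v *)
From HB Require Import structures.
From mathcomp Require Import all_boot all_order all_algebra.
From mathcomp Require Import all_classical all_reals all_analysis.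

Set Implicit Arguments.
Unset Strict Implicit.
Unset Printing Implicit Defensive.

Import Order.TTheory GRing.Theory Num.Theory.
Import numFieldNormedType.Exports.

Local Open Scope classical_set_scope.
Local Open Scope ring_scope.

(* Paths on [a, b] are total functions on R of which only the values on [a, b]
   matter; functions on the simplex are treated likewise.  A partition
   {a = t_0 < ... < t_N = b} is encoded as in the library's [variation]: it is
   the list r = [:: t_1; ...; t_N] with [itv_partition a b r], so that N is
   [size r] and t_k is [nth b (a :: r) k]. *)

Section Paths.
Context {R : realType}.
Implicit Types (p s t T : R).

Definition tensor d (a b : 'rV[R]_d) : 'M[R]_d := \matrix_(i, j) (a 0 i * b 0 j).

(* Euclidean norm on R^d and Frobenius norm on R^(d x d) (the library's norm on
   matrices is the sup norm). *)
Definition enorm m n (A : 'M[R]_(m, n)) : R :=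
  Num.sqrt (\sum_(i < m) \sum_(j < n) A i j ^+ 2).

Definition incr m n (X : R -> 'M[R]_(m, n)) (s t : R) : 'M[R]_(m, n) := X t - X s.

Definition simplex T : set (R * R) :=
  [set st | 0 <= st.1 /\ st.1 <= st.2 /\ st.2 <= T].

Definition cadlag m n (a b : R) (f : R -> 'M[R]_(m, n)) : Prop :=
  (forall t, a <= t < b -> f @ t^'+ --> f t) /\
  (forall t, a < t <= b -> cvg (f @ t^'-)).

Definition pvariation m n p (A : R -> R -> 'M[R]_(m, n)) (s t : R) : \bar R :=
  ((ereal_sup [set (\sum_(0 <= i < size r)
       enorm (A (nth t (s :: r) i) (nth t (s :: r) i.+1)) `^ p)%:E
     | r in itv_partition s t]) `^ p^-1)%E.

Definition Dp m n T p (X : R -> 'M[R]_(m, n)) : Prop :=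
  cadlag 0 T X /\ (pvariation p (incr X) 0 T < +oo)%E.

Definition Dp2 m n T p (A : R -> R -> 'M[R]_(m, n)) : Prop :=
  [/\ (pvariation p A 0 T < +oo)%E,
      forall t, 0 <= t <= T -> cadlag 0 t (fun s => A s t) &
      forall s, 0 <= s <= T -> cadlag s T (fun t => A s t)].

Definition control T (w : R -> R -> R) : Prop :=
  (forall s t, 0 <= s -> s <= t -> t <= T -> 0 <= w s t) /\
  (forall s u t, 0 <= s -> s <= u -> u <= t -> t <= T ->
     w s u + w u t <= w s t).

Definition cadlag_rough_path d T p
    (X Z : R -> 'rV[R]_d) (XX : R -> R -> 'M[R]_d) : Prop :=
  [/\ Dp T p X, Dp T p Z, Dp2 T (p / 2) XX &
      forall s u t, 0 <= s -> s <= u -> u <= t -> t <= T ->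
        XX s t = XX s u + XX u t + tensor (incr Z s u) (incr X u t)].

Definition mesh (a b : R) (r : seq R) : R :=
  \big[Num.max/0]_(k < size r) (nth b (a :: r) k.+1 - nth b (a :: r) k).

Definition refining_partitions T (P : nat -> seq R) : Prop :=
  [/\ forall n, itv_partition 0 T (P n),
      forall n, {subset 0 :: P n <= 0 :: P n.+1} &
      mesh 0 T (P n) @[n --> \oo] --> 0].

Definition step_path d T (S : R -> 'rV[R]_d) (r : seq R) (t : R) : 'rV[R]_d :=
  \1_[set T] t *: S T +
  \sum_(k < size r)
    \1_[set` `[nth T (0 :: r) k, nth T (0 :: r) k.+1[] t *: S (nth T (0 :: r) k).

(* t |-> \int_0^t S^n_u (x) dS_u, for S^n = [step_path T S r] *)
Definition step_integral d T (S : R -> 'rV[R]_d) (r : seq R) (t : R) : 'M[R]_d :=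
  \sum_(k < size r)
    tensor (S (nth T (0 :: r) k))
      (incr S (Num.min (nth T (0 :: r) k) t) (Num.min (nth T (0 :: r) k.+1) t)).

(* I is a version of t |-> \int_0^t S_u (x) dS_u; it is determined on [0, T]. *)
Definition is_RIE_integral d T (P : nat -> seq R) (S : R -> 'rV[R]_d)
    (I : R -> 'M[R]_d) : Prop :=
  {uniform `[0, T], (fun n => step_integral T S (P n)) @ \oo --> I}.

(* The quotients are taken in \bar R, where x / 0 = +oo for x > 0, 0 / 0 = 0. *)
Definition RIE_bound d T p (P : nat -> seq R) (S : R -> 'rV[R]_d)
    (w : R -> R -> R) : Prop :=
  (ereal_sup [set (enorm (incr S st.1 st.2) `^ p)%:E / (w st.1 st.2)%:E
     | st in simplex T] +
   ereal_sup [set ereal_sup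
       [set (let s := nth T (0%R :: P n) kl.1 in
             let t := nth T (0%R :: P n) kl.2 in
             (enorm (incr (step_integral T S (P n)) s t
                     - tensor (S s) (incr S s t))%R `^ (p / 2))%:E
             / (w s t)%:E)
       | kl in [set kl : nat * nat | (kl.1 < kl.2 <= size (P n))%N]]
     | n in [set: nat]]
   <= 1)%E.

Definition RIE d T p (P : nat -> seq R) (S : R -> 'rV[R]_d) : Prop :=
  [/\ {uniform `[0, T], (fun n => step_path T S (P n)) @ \oo --> S},
      exists I, is_RIE_integral T P S I &
      exists w, control T w /\ RIE_bound T p P S w].

End Paths.

(* Main.v *)
Require Import Defs.
From mathcomp Require Import all_boot all_order all_algebra.
From mathcomp Require Import all_classical all_reals all_analysis.
From mathcomp Require Import ring lra.

(* Let A be the second level of the triplet and w the control of (RIE).  The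
   partitions are nested, so (RIE) at level m bounds the m-th approximation of
   A s t for all s, t in P n with n <= m; letting m tend to infinity,
   |A s t|^(p/2) <= w s t whenever s and t lie in a common P n.  This bound need
   not extend to all s <= t, since w need not be right-continuous.  But the
   points of any partition of [0, T] can be pushed to the right into P n, the sum
   over the pushed points is at most w 0 T by superadditivity, and it converges
   to the original sum because S and its integral are right-continuous, the
   latter as a uniform limit of cadlag functions. *)

Set Implicit Arguments.
Unset Strict Implicit.
Unset Printing Implicit Defensive.

Import Order.TTheory GRing.Theory Num.Theory.
Import numFieldNormedType.Exports.

Local Open Scope classical_set_scope.
Local Open Scope ring_scope.

(** * Limits of matrices, of their Euclidean norms and of real powers, along an arbitrary filter *)

Lemma cvg_mx_entry (R : realType) (m n : nat) (T : Type) (F : set_system T)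
    {FF : Filter F} (f : T -> 'M[R]_(m, n)) (A : 'M[R]_(m, n)) :
  (forall i j, f x i j @[x --> F] --> A i j) -> f @ F --> A.
Proof.
move=> fA; apply/cvg_ballP => e e0.
have : \forall x \near F, forall ij : 'I_m * 'I_n,
    ball (A ij.1 ij.2) e (f x ij.1 ij.2).
  by apply: filter_forall => ij; move/cvg_ballP : (fA ij.1 ij.2); exact.
by apply: filterS => x xe; split => // i j; exact: (xe (i, j)).
Qed.

Lemma mx_entry_cvg (R : realType) (m n : nat) (T : Type) (F : set_system T)
    {FF : Filter F} (f : T -> 'M[R]_(m, n)) (A : 'M[R]_(m, n)) i j :
  f @ F --> A -> f x i j @[x --> F] --> A i j.
Proof.
move=> fA.
exact: (cvg_comp _ (fun M : 'M[R]_(m, n) => M i j) fA (@coord_continuous R m n i j A)).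
Qed.

Lemma cvg_enorm (R : realType) (m n : nat) (T : Type) (F : set_system T)
    {FF : Filter F} (f : T -> 'M[R]_(m, n)) (A : 'M[R]_(m, n)) :
  f @ F --> A -> enorm (f x) @[x --> F] --> enorm A.
Proof.
move=> fA; apply: (cvg_comp _ Num.sqrt _ (@sqrt_continuous R _)).
apply: cvg_big => [|i _]; first exact: add_continuous.
apply: cvg_big => [|j _]; first exact: add_continuous.
by rewrite expr2; apply: cvgM; exact: mx_entry_cvg.
Qed.

Lemma cvg_tensor (R : realType) (d : nat) (T : Type) (F : set_system T)
    {FF : Filter F} (f g : T -> 'rV[R]_d) (a b : 'rV[R]_d) :
  f @ F --> a -> g @ F --> b ->
  tensor (f x) (g x) @[x --> F] --> tensor a b.
Proof.
move=> fa gb; apply: cvg_mx_entry => i j.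
under eq_cvg do rewrite mxE.
by rewrite mxE; apply: cvgM; exact: mx_entry_cvg.
Qed.

Lemma enorm_ge0 (R : realType) (m n : nat) (A : 'M[R]_(m, n)) : 0 <= enorm A.
Proof. exact: sqrtr_ge0. Qed.

Lemma enorm0 (R : realType) (m n : nat) : enorm (0 : 'M[R]_(m, n)) = 0.
Proof.
rewrite /enorm big1 ?sqrtr0// => i _.
by rewrite big1// => j _; rewrite mxE expr0n.
Qed.

Lemma cvg_powR (R : realType) (a : R) (T : Type) (F : set_system T)
    {FF : Filter F} (u : T -> R) (l : R) :
  0 < a -> (forall x, 0 <= u x) -> 0 <= l ->
  u @ F --> l -> u x `^ a @[x --> F] --> l `^ a.
Proof.
move=> a0 u0; rewrite le_eqVlt => /predU1P[<-|l0] ul.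
  (* At the limit 0, where [derivable_powR] does not apply, the bound [u x < e^(1/a)] gives [e]
     directly; a positive limit is handled by differentiability. *)
  rewrite powR0 ?gt_eqF//; apply/cvgrPdist_lt => e e0.
  move/cvgrPdist_lt : ul => /(_ (e `^ a^-1)); rewrite powR_gt0// => /(_ isT).
  apply: filterS => x; rewrite !sub0r !normrN !ger0_norm ?powR_ge0// => uxe.
  have -> : e = (e `^ a^-1) `^ a by rewrite -powRrM mulVf ?gt_eqF// powRr1// ltW.
  by apply: gt0_ltr_powR; rewrite // nnegrE ?powR_ge0.
apply: (cvg_comp u (fun x => x `^ a) ul).
have /derivable1_diffP/differentiable_continuous : derivable (@powR R ^~ a) l 1.
  by apply: derivable_powR; rewrite in_itv/= l0.
exact.
Qed.

(** * Stability of càdlàg functions under algebra, stopping and uniform limits *)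

(** Joint continuity of [op] is asked for along every filter, so that one hypothesis serves both for
    right-continuity and for left limits. *)
Lemma cadlag_op2 (R : realType) (m1 n1 m2 n2 m3 n3 : nat)
    (op : 'M[R]_(m1, n1) -> 'M[R]_(m2, n2) -> 'M[R]_(m3, n3)) (a b : R) f g :
  (forall (F : set_system R) (FF : Filter F) (u : R -> 'M[R]_(m1, n1))
      (v : R -> 'M[R]_(m2, n2)) A B,
    u @ F --> A -> v @ F --> B -> op (u x) (v x) @[x --> F] --> op A B) ->
  cadlag a b f -> cadlag a b g -> cadlag a b (fun t => op (f t) (g t)).
Proof.
move=> cop [fr fl] [gr gl]; split=> t abt.
  by apply: cop; [exact: fr|exact: gr].
have /cvg_ex[A fA] := fl t abt; have /cvg_ex[B gB] := gl t abt.
by apply/cvg_ex; exists (op A B); exact: cop.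
Qed.

Lemma cadlag_cst (R : realType) (m n : nat) (a b : R) (A : 'M[R]_(m, n)) :
  cadlag a b (fun=> A).
Proof. by split=> t _; [exact: cvg_cst|exact: is_cvg_cst]. Qed.

Lemma cadlagD (R : realType) (m n : nat) (a b : R) (f g : R -> 'M[R]_(m, n)) :
  cadlag a b f -> cadlag a b g -> cadlag a b (fun t => f t + g t).
Proof. by apply: cadlag_op2 => F FF u v A B; exact: cvgD. Qed.

Lemma cadlagB (R : realType) (m n : nat) (a b : R) (f g : R -> 'M[R]_(m, n)) :
  cadlag a b f -> cadlag a b g -> cadlag a b (fun t => f t - g t).
Proof.
by apply: (@cadlag_op2 _ _ _ _ _ _ _ (fun A B => A - B)) => F FF u v A B; exact: cvgB.
Qed.

Lemma cadlag_tensor (R : realType) (d : nat) (a b : R) (f g : R -> 'rV[R]_d) :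
  cadlag a b f -> cadlag a b g -> cadlag a b (fun t => tensor (f t) (g t)).
Proof. by apply: cadlag_op2 => F FF u v A B; exact: cvg_tensor. Qed.

Lemma cadlag_sum (R : realType) (m n : nat) (a b : R) (I : Type) (r : seq I)
    (f : I -> R -> 'M[R]_(m, n)) :
  (forall i, cadlag a b (f i)) -> cadlag a b (fun t => \sum_(i <- r) f i t).
Proof.
move=> cf; elim: r => [|i r IH].
  by under eq_fun do rewrite big_nil; exact: cadlag_cst.
by under eq_fun do rewrite big_cons; exact: cadlagD.
Qed.

Lemma cadlagW (R : realType) (m n : nat) (a b a' b' : R) (f : R -> 'M[R]_(m, n)) :
  a <= a' -> b' <= b -> cadlag a b f -> cadlag a' b' f.
Proof.
move=> aa bb [fr fl]; split=> t /andP[at_ tb].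
  by apply: fr; rewrite (le_trans aa)//= (lt_le_trans tb).
by apply: fl; rewrite (le_lt_trans aa)//= (le_trans tb).
Qed.

(** The stopped path is locally [f] or locally constant on each side of [t]. At [t = c] the two
    sides differ: constant on the right, [f] on the left. *)
Lemma cadlag_stop (R : realType) (m n : nat) (a b c : R) (f : R -> 'M[R]_(m, n)) :
  a <= c <= b -> cadlag a b f -> cadlag a b (fun t => f (Num.min c t)).
Proof.
move=> /andP[ac cb] [fr fl]; split=> t /andP[at_ tb].
  have [ct|tc] := leP c t.
    apply: cvg_near_cst; near=> x.
    rewrite min_l//; near: x; apply: filterS (nbhs_right_gt t) => x /ltW.
    exact: le_trans.
  apply: cvg_trans (fr t _); last by rewrite at_/=.
  apply: near_eq_cvg; near=> x; rewrite min_r//.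
  by near: x; exact: nbhs_right_le.
have [tc|ct] := leP t c.
  have /cvg_ex[l fl'] := fl t (introT andP (conj at_ tb)).
  apply/cvg_ex; exists l; apply: cvg_trans fl'.
  apply: near_eq_cvg; near=> x; rewrite min_r//.
  by near: x; apply: filterS (nbhs_left_lt t) => x /ltW/le_trans; exact.
apply/cvg_ex; exists (f c); apply: cvg_near_cst; near=> x.
rewrite min_l//; near: x; exact: nbhs_left_ge.
Unshelve. all: by end_near. Qed.

Lemma uniform_cvg_ball (R : realType) (m n : nat) (A : set R)
    (f : nat -> R -> 'M[R]_(m, n)) g e :
  {uniform A, f @ \oo --> g} -> 0 < e ->
  \forall k \near \oo, forall t, A t -> ball (g t) e (f k t).
Proof.
move=> fg e0.
apply: (fg [set h : {uniform` A -> 'M[R]_(m, n)} |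
  forall t, A t -> ball (g t) e (h t)]).
apply/uniform_nbhs; exists [set xy | ball xy.1 e xy.2]; split => //.
exact: entourage_ball (PosNum e0).
Qed.

(** One [f k] uniformly close to [g] transfers right-continuity by an [e / 3] argument. *)
Lemma cadlag_uniform_limit (R : realType) (m n : nat) (a b : R)
    (f : nat -> R -> 'M[R]_(m, n)) g :
  (forall k, cadlag a b (f k)) -> {uniform `[a, b], f @ \oo --> g} ->
  cadlag a b g.
Proof.
move=> cf fg; split=> t /andP[at_ tb].
  apply/cvg_ballP => e e0.
  have e30 : 0 < e / 3 by rewrite divr_gt0.
  have [k /(_ _)/= fk] := filter_ex (uniform_cvg_ball fg e30).
  have /cvg_ballP/(_ _ e30) ft : f k @ t^'+ --> f k t by apply: (cf k).1; rewrite at_.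
  near=> x; have -> : e = e / 3 + e / 3 + e / 3 by lra.
  apply: (@ball_triangle _ _ (f k x)); last first.
    apply/ball_sym/fk; rewrite in_itv/=; apply/andP; split.
      by rewrite (le_trans at_)//; near: x; exact: nbhs_right_ge.
    by near: x; exact: nbhs_right_le.
  apply: (@ball_triangle _ _ (f k t)); last by near: x.
  by apply: fk; rewrite in_itv/= at_ ltW.
(* No candidate for the left limit of [g] is at hand, so completeness is used: for each [e], the
   left limit of one [f k] is the centre of an [e]-ball that contains [g] just before [t]. *)
apply/cauchy_cvgP/cauchy_exP => e e0.
have e20 : 0 < e / 2 by rewrite divr_gt0.
have [k /(_ _)/= fk] := filter_ex (uniform_cvg_ball fg e20).
have /cvg_ex[l /cvg_ballP/(_ _ e20) ft] : cvg (f k @ t^'-).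
  by apply: (cf k).2; rewrite at_.
exists l; rewrite /nbhs/=.
near=> x; apply: (ball_splitl (z := f k x)); first by near: x.
apply/fk; rewrite in_itv/=; apply/andP; split.
  by near: x; exact: nbhs_left_ge.
by rewrite (le_trans _ tb)//; near: x; exact: nbhs_left_le.
Unshelve. all: by end_near. Qed.

(** * Variation sums, control functions and extended quotients *)

Lemma pvariation_lty (R : realType) (m n : nat) (p a b C : R)
    (A : R -> R -> 'M[R]_(m, n)) :
  (forall r, itv_partition a b r ->
    \sum_(0 <= i < size r)
      enorm (A (nth b (a :: r) i) (nth b (a :: r) i.+1)) `^ p <= C) ->
  (pvariation p A a b < +oo)%E.
Proof.
move=> AC; apply/poweR_lty/(le_lt_trans _ (ltry C)).
by apply: ge_ereal_sup => _ [r abr <-]; rewrite lee_fin AC.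
Qed.

(** Iterated superadditivity. The points are only required to be nondecreasing, because distinct
    points may coincide once pushed into a coarser partition. *)
Lemma control_sum_le (R : realType) (T : R) (w : R -> R -> R) (u : nat -> R)
    (n : nat) :
  control T w -> 0 <= u 0%N -> (forall i, (i < n)%N -> u i <= u i.+1) ->
  u n <= T -> \sum_(0 <= i < n) w (u i) (u i.+1) <= w (u 0%N) (u n).
Proof.
move=> [w0 wD] u0; elim: n => [|n IH] uS unT.
  by rewrite big_geq// w0.
have uSn i : (i < n)%N -> u i <= u i.+1 by move=> ni; rewrite uS// ltnS ltnW.
have u0n : u 0%N <= u n.
  by elim: n {IH uS unT} uSn => // n IH uS; rewrite (le_trans (IH _))// => [i ni|];
    rewrite uS// ltnW.
rewrite big_nat_recr//=; apply: le_trans (wD _ (u n) _ _ _ _ _) => //; last exact: uS.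
by rewrite lerD2r IH// (le_trans _ unT)// uS.
Qed.

(** For [y = 0] the quotient is [+oo] unless [x = 0], so the bound forces [x = 0]. *)
Lemma divee_le1 (R : realType) (x y : R) :
  0 <= x -> 0 <= y -> (x%:E / y%:E <= 1)%E -> x <= y.
Proof.
move=> x0; rewrite le_eqVlt => /predU1P[<-|y0].
  rewrite inver eqxx; move: x0; rewrite le_eqVlt => /predU1P[<-//|x0].
  by rewrite gt0_muley ?lte_fin.
by rewrite inver gt_eqF// lee_pdivrMr// mul1e lee_fin.
Qed.

Lemma dive_ge0 (R : realType) (x y : R) :
  0 <= x -> 0 <= y -> (0 <= x%:E / y%:E)%E.
Proof. by move=> x0 y0; rewrite mule_ge0 ?inve_ge0 ?lee_fin. Qed.

(* The least point of the partition a :: r which is >= x, for x <= b. *)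
Definition grid_ceil (R : realType) (a b : R) (r : seq R) (x : R) : R :=
  nth b (a :: r) (find (fun y => x <= y) (a :: r)).

Lemma itv_partition_mem_le (R : realType) (a b : R) (r : seq R) (x : R) :
  itv_partition a b r -> x \in a :: r -> a <= x <= b.
Proof.
move=> abr /(nthP b)[i ir <-].
by rewrite (itv_partition_nth_ge _ abr)// (itv_partition_nth_le _ abr).
Qed.

(** * Pushing points to the right into a partition *)

Section grid_ceil.
Context (R : realType) (a b : R) (r : seq R).
Hypothesis abr : itv_partition a b r.

Let has_ge x : x <= b -> has (fun y => x <= y) (a :: r).
Proof.
move=> xb; apply/hasP; exists b => //.
by move/eqP : abr.2 => <-; exact: mem_last.
Qed.

Lemma grid_ceil_mem x : x <= b -> grid_ceil a b r x \in a :: r.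
Proof. by move=> xb; rewrite mem_nth// -has_find has_ge. Qed.

Lemma grid_ceil_ge x : x <= b -> x <= grid_ceil a b r x.
Proof. by move=> /has_ge/(nth_find b). Qed.

(** A partition point above [y] is also above [x], so the search for [x] stops no later in the
    increasing list. *)
Lemma grid_ceil_le x y : x <= y -> y <= b -> grid_ceil a b r x <= grid_ceil a b r y.
Proof.
move=> xy yb; have : (find (fun z => x <= z)%R (a :: r) <= find (fun z => y <= z)%R (a :: r))%N.
  by apply: sub_find => z; exact: le_trans xy.
rewrite leq_eqVlt /grid_ceil => /predU1P[->//|xy'].
apply/ltW/(sorted_ltn_nth lt_trans); rewrite ?inE//.
- exact: abr.1.
- by rewrite -has_find has_ge// (le_trans xy).
- by rewrite -has_find has_ge.
Qed.

Lemma grid_ceil_left : grid_ceil a b r a = a.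
Proof. by rewrite /grid_ceil/= lexx. Qed.

Lemma grid_ceil_right : grid_ceil a b r b = b.
Proof.
apply/eqP; rewrite eq_le grid_ceil_ge// andbT.
by have /andP[] := itv_partition_mem_le abr (grid_ceil_mem (lexx b)).
Qed.

(** The partition point just before the ceiling lies below [x], so the ceiling exceeds [x] by at
    most one gap. If the ceiling is the first point [a], nonnegativity of the mesh is enough. *)
Lemma grid_ceil_le_mesh x : a <= x <= b -> grid_ceil a b r x <= x + mesh a b r.
Proof.
move=> /andP[ax xb]; rewrite /grid_ceil.
case E : (find _ _) => [|k].
  by rewrite (le_trans ax)// lerDl; exact: bigmax_ge_id.
have kr : (k < size r)%N by rewrite -ltnS -E -/(size (a :: r)) -has_find has_ge.
have /(before_find b)/negbT : (k < find (fun y => x <= y)%R (a :: r))%N by rewrite E.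
rewrite -ltNge => /ltW kx; rewrite -lerBlDl (le_trans _ (le_bigmax _ _ (Ordinal kr)))//.
by rewrite lerD2l lerN2.
Qed.

End grid_ceil.

(** * Pointwise bounds extracted from Property (RIE) *)

(** The two suprema add up to at most 1 and both are nonnegative, so each is at most 1 and every
    single quotient is too. *)
Lemma RIE_bound_incr (R : realType) (d : nat) (T p : R) P (S : R -> 'rV[R]_d) w :
  0 < T -> 0 < p -> (forall n, itv_partition 0 T (P n)) -> control T w ->
  RIE_bound T p P S w ->
  (forall s t, 0 <= s -> s <= t -> t <= T -> enorm (incr S s t) `^ p <= w s t) /\
  (forall n s t, s \in 0 :: P n -> t \in 0 :: P n -> s <= t ->
    enorm (incr (step_integral T S (P n)) s t - tensor (S s) (incr S s t))
      `^ (p / 2) <= w s t).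
Proof.
move=> T0 p0 PT [w0 wD] bnd.
have q1 s t : 0 <= s -> s <= t -> t <= T ->
    (0 <= (enorm (incr S s t) `^ p)%:E / (w s t)%:E)%E.
  by move=> s0 st tT; rewrite dive_ge0 ?powR_ge0// w0.
pose q n kl := let s := nth T (0 :: P n) kl.1 in let t := nth T (0 :: P n) kl.2 in
  ((enorm (incr (step_integral T S (P n)) s t - tensor (S s) (incr S s t))%R
     `^ (p / 2))%:E / (w s t)%:E)%E.
(* An index past the end returns the default [T], which is still in [[0, T]]. *)
have nthP n k : 0 <= nth T (0 :: P n) k <= T.
  have [kn|nk] := ltnP k (size (P n)).+1.
    by rewrite (itv_partition_nth_ge _ (PT n))// (itv_partition_nth_le _ (PT n)).
  by rewrite nth_default// lexx ltW.
have nth_lt n k l : (k < l <= size (P n))%N -> nth T (0 :: P n) k <= nth T (0 :: P n) l.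
  move=> /andP[kl ln]; apply/ltW/(sorted_ltn_nth lt_trans); rewrite ?inE//=.
  - exact: (PT n).1.
  - by rewrite ltnS (leq_trans _ ln)// ltnW.
have q2 n k l : (k < l <= size (P n))%N -> (0 <= q n (k, l))%E.
  move=> kl; rewrite dive_ge0 ?powR_ge0//= w0 ?nth_lt//.
    by have /andP[] := nthP n k.
  by have /andP[] := nthP n l.
move: bnd; rewrite /RIE_bound; set s1 := ereal_sup _; set s2 := ereal_sup _ => bnd.
have s1_ub s t : 0 <= s -> s <= t -> t <= T ->
    ((enorm (incr S s t) `^ p)%:E / (w s t)%:E <= s1)%E.
  by move=> s0 st tT; apply: ereal_sup_ubound; exists (s, t).
have s2_ub n k l : (k < l <= size (P n))%N -> (q n (k, l) <= s2)%E.
  move=> kl; apply: le_trans (ereal_sup_ubound _); last by exists n.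
  by apply: ereal_sup_ubound; exists (k, l).
have s1_ge0 : (0 <= s1)%E.
  by apply: le_trans (q1 0 0 _ _ _) (s1_ub 0 0 _ _ _); rewrite ?(ltW T0).
have s2_ge0 : (0 <= s2)%E.
  (* Since [0 < T], the partition [P 0] has an interval; the supremum is thus over a nonempty family
     and cannot be [-oo]. *)
  have szP : (0 < size (P 0) <= size (P 0))%N.
    by rewrite leqnn andbT; case: (P 0%N) (PT 0%N) => // /itv_partition_nil T0E;
      rewrite -T0E ltxx in T0.
  by apply: le_trans (q2 0%N _ _ szP) (s2_ub _ _ _ szP).
split=> [s t s0 st tT|n s t sP tP st].
  apply: divee_le1; [exact: powR_ge0|exact: w0|].
  by apply: le_trans (s1_ub _ _ s0 st tT) (le_trans _ bnd); exact: leeDl.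
have /andP[s0 sT] := itv_partition_mem_le (PT n) sP.
have /andP[t0 tT] := itv_partition_mem_le (PT n) tP.
(* The supremum only covers indices [k < l]. For [s = t] the left side is 0, as [p / 2] is
   positive. *)
move: st; rewrite le_eqVlt => /predU1P[<-|st].
  rewrite /incr !subrr (_ : tensor _ _ = 0) ?subr0 ?enorm0; last first.
    by apply/matrixP => i j; rewrite !mxE mulr0.
  by rewrite powR0 ?w0// gt_eqF// divr_gt0.
apply: divee_le1; [exact: powR_ge0|exact/w0/tT/ltW|].
have kl : (index s (0%R :: P n) < index t (0%R :: P n) <= size (P n))%N.
  apply/andP; split; last by rewrite -ltnS -[X in (_ < X)%N]/(size (0%R :: P n)) index_mem.
  rewrite ltnNge; apply/negP => ts; move: st; rewrite ltNge => /negP; apply.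
  rewrite -(nth_index T sP) -(nth_index T tP); move: ts.
  rewrite leq_eqVlt => /predU1P[->//|ts]; apply: nth_lt.
  by rewrite ts -ltnS -[X in (_ < X)%N]/(size (0%R :: P n)) index_mem.
apply: le_trans (le_trans _ bnd); last by apply: leeDr s1_ge0.
by have := s2_ub _ _ _ kl; rewrite /q/= !nth_index.
Qed.

(** * Limits along the sequence of partitions, and the approximating integrals *)

(** The ceilings approach [x] from the right because the mesh vanishes. At [x = b], where nothing is
    assumed to the right, the ceiling is [b] itself. *)
Lemma cvg_grid_ceil (R : realType) (V : topologicalType) (a b x : R)
    (P : nat -> seq R) (f : R -> V) :
  (forall n, itv_partition a b (P n)) -> mesh a b (P n) @[n --> \oo] --> 0 ->
  a <= x <= b -> (x < b -> f @ x^'+ --> f x) ->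
  f (grid_ceil a b (P n) x) @[n --> \oo] --> f x.
Proof.
move=> abP P0 /andP[ax]; rewrite le_eqVlt => /predU1P[->|xb] fx.
  by under eq_fun do rewrite grid_ceil_right//; exact: cvg_cst.
(* A ceiling may equal [x], a point that [x^'+] leaves out; the limit is therefore restated on
   neighbourhoods within the closed half-line from [x]. *)
have {}fx := cvg_at_right_within (fx xb).
apply: (cvg_comp (fun n => grid_ceil a b (P n) x) f _ fx).
have cx : grid_ceil a b (P n) x @[n --> \oo] --> x.
  apply: (@squeeze_cvgr _ _ _ _ (fun=> x) (fun n => x + mesh a b (P n))).
  - apply: nearW => n /=; rewrite grid_ceil_ge ?(ltW xb)//=.
    by rewrite grid_ceil_le_mesh// ax ltW.
  - exact: cvg_cst.
  - by rewrite -[X in _ --> X]addr0; apply: cvgD => //; exact: cvg_cst.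
move=> A wA; change (\forall n \near \oo, A (grid_ceil a b (P n) x)).
have : \forall n \near \oo, x <= grid_ceil a b (P n) x -> A (grid_ceil a b (P n) x).
  exact: (cx _ wA).
apply: filterS => n; apply.
exact: (grid_ceil_ge (abP n) (ltW xb)).
Qed.

Lemma limr_leW (R : realType) (f : nat -> R) (l C : R) :
  f @ \oo --> l -> (\forall n \near \oo, f n <= C) -> l <= C.
Proof.
by move=> fl fC; rewrite -(cvg_lim _ fl)//; apply: limr_le => //; exact: cvgP fl.
Qed.

Lemma cvg_sum_nat (R : realType) (f : nat -> nat -> R) (l : nat -> R) N :
  (forall i, (i < N)%N -> f n i @[n --> \oo] --> l i) ->
  \sum_(0 <= i < N) f n i @[n --> \oo] --> \sum_(0 <= i < N) l i.
Proof.
move=> fl; rewrite big_mkord; under eq_fun do rewrite big_mkord.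
by apply: cvg_big => [|i _]; [exact: add_continuous|exact: fl].
Qed.

Lemma itv_partition_nth_incr (R : realType) (a b : R) (r : seq R) i :
  itv_partition a b r -> (i < size r)%N ->
  [/\ a <= nth b (a :: r) i, nth b (a :: r) i <= nth b (a :: r) i.+1
    & nth b (a :: r) i.+1 <= b].
Proof.
move=> abr ir; split; last exact: (itv_partition_nth_le _ abr).
  by rewrite (itv_partition_nth_ge _ abr)// ltnS ltnW.
by apply/ltW/(sorted_ltn_nth lt_trans); rewrite ?inE//= ?ltnS ?(ltnW ir)//; exact: abr.1.
Qed.

(** Each summand is a constant tensored with the difference of two stopped copies of [S]. *)
Lemma cadlag_step_integral (R : realType) (d : nat) (T : R) (S : R -> 'rV[R]_d)
    (r : seq R) :
  itv_partition 0 T r -> cadlag 0 T S -> cadlag 0 T (step_integral T S r).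
Proof.
move=> Tr cS; apply: cadlag_sum => k.
have [t0 tt tT] := itv_partition_nth_incr Tr (ltn_ord k).
apply: cadlag_tensor; first exact: cadlag_cst.
by apply: cadlagB; apply: cadlag_stop => //; apply/andP; split=> //;
  [exact: le_trans tt|exact: le_trans tT].
Qed.

Lemma nested_partitionsS (R : realType) (T : R) (P : nat -> seq R) n k :
  (forall n, {subset 0 :: P n <= 0 :: P n.+1}) ->
  (n <= k)%N -> {subset 0 :: P n <= 0 :: P k}.
Proof.
move=> PS /subnK <-; elim: (k - n)%N => // i IH x xn; rewrite addSn.
exact/PS/IH.
Qed.

Lemma uniform_cvg_pointwise (R : realType) (m n : nat) (A : set R)
    (f : nat -> R -> 'M[R]_(m, n)) g t :
  {uniform A, f @ \oo --> g} -> A t -> f k t @[k --> \oo] --> g t.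
Proof.
move=> fg At; apply/cvg_ballP => e e0.
by apply: filterS (uniform_cvg_ball fg e0) => k; exact.
Qed.


(** The increments of [I] are additive and cancel; what remains is bilinearity of the tensor product
    together with [S s = S u - incr S s u]. *)
Lemma chen_relation (R : realType) (d : nat) (S : R -> 'rV[R]_d)
    (I : R -> 'M[R]_d) s u t :
  incr I s t - tensor (S s) (incr S s t) =
  incr I s u - tensor (S s) (incr S s u) +
  (incr I u t - tensor (S u) (incr S u t)) + tensor (incr S s u) (incr S u t).
Proof. by rewrite /incr; apply/matrixP => i j; rewrite !mxE; ring. Qed.

Theorem lemma2p12 (R : realType) (d : nat) (T p : R) (P : nat -> seq R)
    (S : R -> 'rV[R]_d) (I : R -> 'M[R]_d)
    (T_gt0 : 0 < T) (p_gt2 : 2 < p) (p_lt3 : p < 3)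
    (P_refining : refining_partitions T P)
    (S_cadlag : cadlag 0 T S)
    (S_RIE : RIE T p P S)
    (I_integral : is_RIE_integral T P S I) :
  cadlag_rough_path T p S S
    (fun s t => incr I s t - tensor (S s) (incr S s t)).
Proof.
have [PT PS P0] := P_refining.
have [_ _ [w [w_control /(RIE_bound_incr T_gt0 _ PT w_control)]]] := S_RIE.
case; first by rewrite (lt_trans _ p_gt2).
move=> S_le An_le.
have p2_gt0 : 0 < p / 2 by rewrite divr_gt0// (lt_trans _ p_gt2).
have I_cadlag : cadlag 0 T I.
  by apply: cadlag_uniform_limit I_integral => n; exact: cadlag_step_integral.
set A := fun s t : R => _.
have A_le n s t : s \in 0 :: P n -> t \in 0 :: P n -> s <= t ->
    enorm (A s t) `^ (p / 2) <= w s t.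
  move=> sP tP st.
  have I_cvg u : u \in 0 :: P n -> step_integral T S (P k) u @[k --> \oo] --> I u.
    move=> /(itv_partition_mem_le (PT n)) uT.
    by apply: (uniform_cvg_pointwise I_integral); rewrite /= in_itv.
  apply: (@limr_leW _ (fun k => enorm (incr (step_integral T S (P k)) s t
      - tensor (S s) (incr S s t)) `^ (p / 2))).
    apply: cvg_powR => // [k||]; try exact: enorm_ge0.
    apply: cvg_enorm; apply: cvgB; last exact: cvg_cst.
    by apply: cvgB; exact: I_cvg.
  (* Nestedness keeps [s] and [t] in [P k] for all [k >= n], so the level-[k] bound applies with the
     same right side [w s t]. *)
  near=> k; have PnPk : {subset 0 :: P n <= 0 :: P k}.
    by apply: nested_partitionsS => //; near: k; exact: nbhs_infty_ge.
  by apply: An_le; rewrite ?PnPk.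
(* At the first level the control bound holds for all [s <= t], so the points of any partition can
   be used without being pushed. *)
have S_Dp : Dp T p S.
  split=> //; apply: (@pvariation_lty _ _ _ _ _ _ (w 0 T)) => r Tr.
  apply: (@le_trans _ _ (\sum_(0 <= i < size r)
      w (nth T (0 :: r) i) (nth T (0 :: r) i.+1))).
    apply: ler_sum_nat => i /andP[_ /(itv_partition_nth_incr Tr)[? ? ?]].
    exact: S_le.
  rewrite -[X in _ <= w 0 X](itv_partition_nth_size T Tr).
  apply: (@control_sum_le _ T) => //.
    by move=> i /(itv_partition_nth_incr Tr)[].
  by rewrite (itv_partition_nth_size T Tr).
split=> //; last by move=> s u t _ _ _ _; exact: chen_relation.
split.
- apply: (@pvariation_lty _ _ _ _ _ _ (w 0 T)) => r Tr.
  pose c n := grid_ceil 0 T (P n).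
  (* The points of [r] pushed into [P n]: nondecreasing in [i], with both endpoints kept. *)
  pose u n i := c n (nth T (0 :: r) i).
  (* Both arguments of [A] move at once, so separate right-continuity in each would not suffice.
     Instead [A] is split into the one-parameter functions [I] and [S], which converge along the
     pushed points. *)
  have A_cvg i : (i < size r)%N ->
      A (u n i) (u n i.+1) @[n --> \oo]
        --> A (nth T (0 :: r) i) (nth T (0 :: r) i.+1).
    move=> /(itv_partition_nth_incr Tr)[s0 st tT].
    have c_cvg m k (f : R -> 'M[R]_(m, k)) x : 0 <= x -> x <= T ->
        cadlag 0 T f -> f (c n x) @[n --> \oo] --> f x.
      move=> x0 xT [fr _]; apply: cvg_grid_ceil => //; first exact/andP.
      by move=> xT'; apply: fr; rewrite x0.
    have [sT t0] := (le_trans st tT, le_trans s0 st).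
    have [Is It] := (c_cvg _ _ I _ s0 sT I_cadlag, c_cvg _ _ I _ t0 tT I_cadlag).
    have [Ss St] := (c_cvg _ _ S _ s0 sT S_cadlag, c_cvg _ _ S _ t0 tT S_cadlag).
    exact: cvgB (cvgB It Is) (cvg_tensor Ss (cvgB St Ss)).
  apply: (@limr_leW _ (fun n => \sum_(0 <= i < size r)
      enorm (A (u n i) (u n i.+1)) `^ (p / 2))).
    apply: cvg_sum_nat => i ir; apply: cvg_powR => // [k||]; try exact: enorm_ge0.
    exact: (cvg_enorm (A_cvg i ir)).
  apply: nearW => n.
  have u_le i : (i < size r)%N -> u n i <= u n i.+1.
    by move=> /(itv_partition_nth_incr Tr)[_ st tT]; exact: grid_ceil_le.
  have u_left : u n 0 = 0 by rewrite /u /c grid_ceil_left.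
  have u_right : u n (size r) = T.
    by rewrite /u (itv_partition_nth_size T Tr) /c grid_ceil_right.
  (* For fixed [n] all pushed points lie in the single partition [P n], so [A_le] bounds every term;
     superadditivity then yields [w 0 T], independently of [n] and [r]. *)
  apply: (@le_trans _ _ (\sum_(0 <= i < size r) w (u n i) (u n i.+1))).
    apply: ler_sum_nat => i /andP[_ ir].
    have [_ st tT] := itv_partition_nth_incr Tr ir.
    apply: (A_le n); [|exact: grid_ceil_mem|exact: u_le].
    by apply: grid_ceil_mem => //; exact: le_trans tT.
  have := @control_sum_le _ T w (u n) (size r) w_control.
  by rewrite u_left u_right; apply.
(* With one argument fixed, [A] is a combination of constants, [I] and [S] under differences and
   tensor products, restricted to a subinterval. *)
- move=> t /andP[t0 tT].
  have [I_cadlag' S_cadlag'] := (cadlagW (lexx 0) tT I_cadlag,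
    cadlagW (lexx 0) tT S_cadlag).
  have dB m n (f : R -> 'M[R]_(m, n)) : cadlag 0 t f -> cadlag 0 t (fun s => f t - f s).
    exact: (cadlagB (cadlag_cst _ _ _)).
  by apply: cadlagB; [exact: dB|apply: cadlag_tensor; [|exact: dB]].
- move=> s /andP[s0 sT].
  have [I_cadlag' S_cadlag'] := (cadlagW s0 (lexx T) I_cadlag,
    cadlagW s0 (lexx T) S_cadlag).
  have dB m n (f : R -> 'M[R]_(m, n)) : cadlag s T f -> cadlag s T (fun t => f t - f s).
    by move=> cf; exact: cadlagB cf (cadlag_cst _ _ _).
  by apply: cadlagB; [exact: dB|apply: cadlag_tensor; [exact: cadlag_cst|exact: dB]].
Unshelve. all: by end_near. Qed.
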